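(* Let $(\kappa,k_1,k_2)\in\mathcal{L}_1^1$. On the space $C_{-1,(k_2)}^{1}(0,+\infty)$, the 1st level GFD exists in the usual sense and coincides with the 1st level AGFD; i.e., for every $f\in C_{-1,(k_2)}^{1}(0,+\infty)$, the function $\left(\mathbb{I}_{(k_1)}\frac{d}{dt}\mathbb{I}_{(k_2)}f\right)(t)$ exists and, when all functions from the ring $\mathcal{R}_{-1}$ are interpreted as elements of the field $\mathcal{F}_{-1}$ via the embedding of $\mathcal{R}_{-1}$ into $\mathcal{F}_{-1}$, $$\left(\mathbb{I}_{(k_1)}\frac{d}{dt}\mathbb{I}_{(k_2)}f\right)(t)=({}_{1L}\mathbb{D}_{(k_1,k_2)}f)(t)={}_{1L}\mathbb{D}_{(k_1,k_2)}\,f=S_\kappa\cdot f-(\mathbb{I}_{(k_2)}f)(0)\,k_1(t),$$ where ${}_{1L}\mathbb{D}_{(k_1,k_2)}\,f$ (without argument) denotes the 1st level AGFD of $f$.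
   Context: $C_{-1}(0,+\infty)$ is the space of functions $f$ on $(0,+\infty)$ of the form $f(t)=t^{p}f_1(t)$, $t>0$, with some $p>-1$ and $f_1\in C[0,+\infty)$. The symbol $*$ denotes the Laplace convolution $(f*g)(t)=\int_0^t f(t-\tau)g(\tau)\,d\tau$, $t>0$; $\kappa^{<2>}=\kappa*\kappa$. $\mathcal{L}_1^1$ is the set of triples $(\kappa,k_1,k_2)$ of real-valued functions belonging to $C_{-1}(0,+\infty)$ with $(\kappa*k_1*k_2)(t)=1$ for all $t>0$ (1st level kernels). For $k\in C_{-1}(0,+\infty)$: $(\mathbb{I}_{(k)}f)(t)=(k*f)(t)$ (general fractional integral, GFI), $(\mathbb{D}_{(k)}f)(t)=\frac{d}{dt}(\mathbb{I}_{(k)}f)(t)$, and the 1st level general fractional derivative (1st level GFD) is $({}_{1L}\mathbb{D}_{(k_1,k_2)}f)(t)=\left(\mathbb{I}_{(k_1)}\frac{d}{dt}\mathbb{I}_{(k_2)}f\right)(t)$. Further, $$C_{-1,(k)}^{1}(0,+\infty)=\{f\in C_{-1}(0,+\infty):\ \mathbb{D}_{(k)}f\in C_{-1}(0,+\infty)\}.$$ The value $(\mathbb{I}_{(k_2)}f)(0)$ is the value at $0$ of the continuous extension of $\mathbb{I}_{(k_2)}f$ to $[0,+\infty)$, i.e. $\lim_{t\to0+}(\mathbb{I}_{(k_2)}f)(t)$. $\mathcal{R}_{-1}=(C_{-1}(0,+\infty),+,* )$ is a commutative ring without unity and without divisors of zero. $\mathcal{F}_{-1}$ is its field of convolution quotients: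 equivalence classes $\frac{f}{g}$ of pairs $(f,g)$ with $f\in C_{-1}(0,+\infty)$, $g\in C_{-1}(0,+\infty)\setminus\{0\}$, under $(f_1,g_1)\sim(f_2,g_2)\Leftrightarrow f_1*g_2=f_2*g_1$, with the usual fraction addition $\frac{f_1}{g_1}+\frac{f_2}{g_2}=\frac{f_1*g_2+f_2*g_1}{g_1*g_2}$ and multiplication $\frac{f_1}{g_1}\cdot\frac{f_2}{g_2}=\frac{f_1*f_2}{g_1*g_2}$, and with scalar multiplication $\lambda\frac{f}{g}=\frac{\lambda f}{g}$. The ring $\mathcal{R}_{-1}$ is embedded in $\mathcal{F}_{-1}$ by $f\mapsto\frac{f*\kappa}{\kappa}$. The element $S_\kappa=\frac{\kappa}{\kappa^{<2>}}\in\mathcal{F}_{-1}$ is the algebraic inverse to the GFI with kernel $\kappa$ (it is the multiplicative inverse of $\kappa$ in $\mathcal{F}_{-1}$). The 1st level algebraic general fractional derivative (1st level AGFD) of $f$ is the element of $\mathcal{F}_{-1}$ given by $${}_{1L}\mathbb{D}_{(k_1,k_2)}\,f:=S_\kappa\cdot f-S_\kappa\cdot(P_{1L}f),\qquad (P_{1L}f)(t)=(\mathbb{I}_{(k_2)}f)(0)\,(\kappa*k_1)(t),$$ where $f$ and $P_{1L}f$ are interpreted as elements of $\mathcal{F}_{-1}$; it is defined whenever $f\in C_{-1}(0,+\infty)$ and $\mathbb{I}_{(k_2)}f\in C[0,+\infty)$. *)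

(* Defs.v *)
From mathcomp Require Import all_boot all_order all_algebra.
From mathcomp Require Import all_classical all_reals all_analysis.

Set Implicit Arguments.
Unset Strict Implicit.
Unset Printing Implicit Defensive.

Import Order.TTheory GRing.Theory Num.Theory.
Import numFieldNormedType.Exports.

Local Open Scope classical_set_scope.
Local Open Scope ring_scope.

(* A function on (0, +oo) is represented by a total function R -> R of which
   only the values at t > 0 matter: every notion below depends on its function
   arguments through their restrictions to (0, +oo) only. *)

Definition Cm1 (R : realType) (f : R -> R) : Prop :=
  exists (p : R) (f1 : R -> R),
    [/\ -1 < p,
        {within `[0, +oo[, continuous f1} &
        forall t, 0 < t -> f t = t `^ p * f1 t].

Definition C0_ext (R : realType) (f : R -> R) : Prop :=
  exists g : R -> R,
    {within `[0, +oo[, continuous g} /\ forall t, 0 < t -> f t = g t.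

(* Rintegral takes a junk value on non-integrable functions; lconv_ex says
   that the integral is a genuine one. *)
Definition lconv (R : realType) (f g : R -> R) (t : R) : R :=
  \int[lebesgue_measure]_(x in `]0, t[) (f (t - x) * g x).

Definition lconv_ex (R : realType) (f g : R -> R) (t : R) : Prop :=
  lebesgue_measure.-integrable `]0, t[ (fun x => (f (t - x) * g x)%:E).

Definition L11 (R : realType) (kappa k1 k2 : R -> R) : Prop :=
  [/\ Cm1 kappa, Cm1 k1, Cm1 k2 &
      forall t, 0 < t -> lconv (lconv kappa k1) k2 t = 1].

Definition GFI (R : realType) (k f : R -> R) : R -> R := lconv k f.

Definition GFD (R : realType) (k f : R -> R) : R -> R := derive1 (GFI k f).

(* derive1 is total, so the existence of GFD k f on (0, +oo), implicit in
   "GFD k f belongs to C_{-1}(0, +oo)", is a separate clause. *)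
Definition C1m1 (R : realType) (k f : R -> R) : Prop :=
  [/\ Cm1 f,
      forall t, 0 < t -> derivable (GFI k f) t 1 &
      Cm1 (GFD k f)].

Definition GFD1 (R : realType) (k1 k2 f : R -> R) : R -> R :=
  GFI k1 (derive1 (GFI k2 f)).

Definition GFD1_ex (R : realType) (k1 k2 f : R -> R) : Prop :=
  forall t, 0 < t ->
    [/\ lconv_ex k2 f t,
        derivable (GFI k2 f) t 1 &
        lconv_ex k1 (derive1 (GFI k2 f)) t].

Definition GFI_at0 (R : realType) (k f : R -> R) : R :=
  lim (GFI k f t @[t --> 0^'+]).

Definition cpair (R : realType) (p : (R -> R) * (R -> R)) : Prop :=
  [/\ Cm1 p.1, Cm1 p.2 & exists2 t, 0 < t & p.2 t != 0].

Definition cequiv (R : realType) (p q : (R -> R) * (R -> R)) : Prop :=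
  forall t, 0 < t -> lconv p.1 q.2 t = lconv q.1 p.2 t.

(* A convolution quotient is an equivalence class of pairs, i.e. a set of
   pairs; equality of quotients is equality of sets. *)
Definition cquot (R : realType) : Type := set ((R -> R) * (R -> R)).

Definition cfrac (R : realType) (f g : R -> R) : cquot R :=
  [set p | cpair p /\ cequiv p (f, g)].

(* The class of the result computed from representatives a of A and b of B is
   the same for all a and b (the ring C_{-1}(0,+oo) has no zero divisors), so
   the intersection over all representatives of the (nonempty) classes A and B
   is that common class. *)
Definition cq_add (R : realType) (A B : cquot R) : cquot R :=
  \bigcap_(a in A) \bigcap_(b in B)
    cfrac (lconv a.1 b.2 \+ lconv b.1 a.2) (lconv a.2 b.2).

Definition cq_mul (R : realType) (A B : cquot R) : cquot R :=
  \bigcap_(a in A) \bigcap_(b in B) cfrac (lconv a.1 b.1) (lconv a.2 b.2).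

Definition cq_scale (R : realType) (c : R) (A : cquot R) : cquot R :=
  \bigcap_(a in A) cfrac (fun t => c * a.1 t) a.2.

Definition cq_sub (R : realType) (A B : cquot R) : cquot R :=
  cq_add A (cq_scale (-1) B).

Definition cq_emb (R : realType) (kappa f : R -> R) : cquot R :=
  cfrac (lconv f kappa) kappa.

Definition cq_S (R : realType) (kappa : R -> R) : cquot R :=
  cfrac kappa (lconv kappa kappa).

Definition P1L (R : realType) (kappa k1 k2 f : R -> R) : R -> R :=
  fun t => GFI_at0 k2 f * lconv kappa k1 t.

(* Meaningful when Cm1 f and C0_ext (GFI k2 f). *)
Definition AGFD1 (R : realType) (kappa k1 k2 f : R -> R) : cquot R :=
  cq_sub (cq_mul (cq_S kappa) (cq_emb kappa f))
         (cq_mul (cq_S kappa) (cq_emb kappa (P1L kappa k1 k2 f))).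

(* Main.v *)
Require Import Defs.
From mathcomp Require Import all_boot all_order all_algebra.
From mathcomp Require Import all_classical all_reals all_analysis.
From mathcomp Require Import measurable_realfun lra ring.

(* The functions in C_{-1} form a commutative ring under Laplace convolution.
   Since [kappa * k1 * k2 = 1], and [1 * h = 0] forces [h = 0] by
   differentiation, both [kappa] and [k2] are cancellable in it.

   Put [g = k2 * f] and [c = g(0+)]. As g' is in C_{-1}, it is integrable at 0
   and [g = c + 1 * g'], so
     [k2 * (kappa * k1 * g') = 1 * g' = k2 * f - c = k2 * (f - c (kappa * k1))],
   and cancelling [k2] gives [kappa * (k1 * g') = f - c (kappa * k1)]. Dividing
   by [kappa] is the claim.

   All quotients involved have a representative whose denominator is a power of
   [kappa], hence cancellable. The intersections that define sums and products
   are attained at these representatives, so the absence of zero divisors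
   (Titchmarsh's theorem) is not needed. *)

Set Implicit Arguments.
Unset Strict Implicit.
Unset Printing Implicit Defensive.

Import Order.TTheory GRing.Theory Num.Theory.
Import numFieldNormedType.Exports.

Local Open Scope classical_set_scope.
Local Open Scope ring_scope.

(** * The space C_{-1} *)

Section half_line_continuity.
Variable R : realType.
Implicit Types (f g : R -> R) (p q r x t : R).

Lemma continuous_max0 : continuous (fun x : R => Num.max 0 x).
Proof.
move=> x; apply: (@continuous_max R R (cst 0) id); first exact: cst_continuous.
exact: cvg_id.
Qed.

(** Freezing [f] at [f 0] on the negative axis turns continuity on the closed half-line into plain
    continuity, the form used from here on. *)
Lemma continuous_comp_max0 f :
  {within `[0, +oo[, continuous f} -> continuous (fun x => f (Num.max 0 x)).
Proof.
move=> cf x.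
have m0 (y : R) : `[0, +oo[%classic (Num.max 0 y).
  by rewrite /= in_itv/= andbT le_max lexx.
have : f y @[y --> within `[0, +oo[%classic (nbhs (Num.max 0 x))] -->
    f (Num.max 0 x).
  by have /subspace_continuousP := cf; exact.
apply: cvg_comp.
move=> A /=; rewrite /within/= => nA.
have h : nbhs x (fun y : R =>
    `[0, +oo[%classic (Num.max 0 y) -> A (Num.max 0 y)).
  exact: (continuous_max0 nA).
by apply: (@filterS R _ _ _ _ _ h) => y; apply; exact: m0.
Qed.

(** At the origin, [r > 0] gives the limit 0, while for [r = 0] the convention [0 ^ 0 = 1] makes the
    function constant. *)
Lemma continuous_powR_max0 r : 0 <= r ->
  continuous (fun x => (Num.max 0 x) `^ r).
Proof.
rewrite le_eqVlt => /predU1P[<-|r0].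
  rewrite (_ : (fun x => _) = cst 1); first exact: cst_continuous.
  by apply/funext => x; rewrite powRr0.
apply: (@continuous_comp_max0 (@powR R ^~ r)).
apply/continuous_within_itvcyP; split.
  move=> x; rewrite in_itv/= andbT => x0.
  apply/differentiable_continuous/derivable1_diffP/derivable_powR.
  by rewrite in_itv/= x0.
by rewrite powR0 ?gt_eqF//; exact: powR_cvg0.
Qed.

(* With [p <= 0], [x `^ p] is bounded on every half-line [a <= x], [0 < a]. *)
Definition Cm1_form (p : R) f1 f :=
  [/\ -1 < p <= 0, continuous f1 & forall t, 0 < t -> f t = t `^ p * f1 t].

Lemma Cm1_formW p f1 f : Cm1_form p f1 f -> Cm1 f.
Proof.
move=> [/andP[p1 _] cf1 ff1]; exists p, f1; split => //.
exact: continuous_subspaceT.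
Qed.

(** Lowers an exponent from [p] to [q]: when [q <= p], the surplus power is continuous on the whole
    line and can be absorbed into the continuous factor. *)
Lemma powR_lower p q t : 0 < t ->
  t `^ p = t `^ q * Num.max 0 t `^ (p - q).
Proof.
move=> t0; rewrite (max_idPr (ltW t0)) -powRD ?subrKC//.
by rewrite (gt_eqF t0) implybT.
Qed.

Lemma Cm1_intro p f f1 : -1 < p -> continuous f1 ->
  (forall t, 0 < t -> f t = t `^ p * f1 t) ->
  exists g1, Cm1_form (Num.min p 0) g1 f.
Proof.
move=> p1 cf1 ff1; set q := Num.min p 0.
exists (fun x => Num.max 0 x `^ (p - q) * f1 x); split.
- by rewrite lt_min p1 ltrN10 ge_min lexx orbT.
- move=> x; apply: (@continuousM _ _ (fun x => Num.max 0 x `^ (p - q)) f1).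
    by apply: continuous_powR_max0; rewrite subr_ge0 ge_min lexx.
  exact: cf1.
- by move=> t t0; rewrite mulrA -powR_lower// ff1.
Qed.

Lemma Cm1_formP f : Cm1 f -> exists p f1, Cm1_form p f1 f.
Proof.
move=> [p [f1 [p1 cf1 ff1]]].
have [|g1 g1P] := @Cm1_intro p f _ p1 (continuous_comp_max0 cf1).
  by move=> t t0; rewrite (max_idPr (ltW t0)) ff1.
by exists (Num.min p 0), g1.
Qed.

(** Serves to bring the two terms of a sum to a common exponent, the smaller one. *)
Lemma Cm1_form_lower p q f1 f : -1 < q <= p -> Cm1_form p f1 f ->
  exists g1, Cm1_form q g1 f.
Proof.
move=> /andP[q1 qp] [/andP[p1 p0] cf1 ff1].
exists (fun x => Num.max 0 x `^ (p - q) * f1 x); split.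
- by rewrite q1 (le_trans qp).
- move=> x; apply: (@continuousM _ _ (fun x => Num.max 0 x `^ (p - q)) f1).
    by apply: continuous_powR_max0; rewrite subr_ge0.
  exact: cf1.
- by move=> t t0; rewrite mulrA -powR_lower// ff1.
Qed.

Lemma Cm1D f g : Cm1 f -> Cm1 g -> Cm1 (f \+ g).
Proof.
move=> /Cm1_formP[p [f1 fP]] /Cm1_formP[q [g1 gP]].
have p1 : -1 < p by case: fP => /andP[].
have q1 : -1 < q by case: gP => /andP[].
have [|f2 [r1 cf2 ff2]] := @Cm1_form_lower p (Num.min p q) _ f _ fP.
  by rewrite lt_min p1 q1 ge_min lexx.
have [|g2 [_ cg2 gg2]] := @Cm1_form_lower q (Num.min p q) _ g _ gP.
  by rewrite lt_min p1 q1 ge_min lexx orbT.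
apply: (@Cm1_formW (Num.min p q) (f2 \+ g2)); split => //.
- by move=> x; apply: continuousD; [exact: cf2|exact: cg2].
- by move=> t t0 /=; rewrite ff2// gg2// mulrDr.
Qed.

Lemma Cm1Z c f : Cm1 f -> Cm1 (fun t => c * f t).
Proof.
move=> /Cm1_formP[p [f1 [p1 cf1 ff1]]].
apply: (@Cm1_formW p (fun t => c * f1 t)); split => //.
- by move=> x; apply: continuousM; [exact: cst_continuous|exact: cf1].
- by move=> t t0 /=; rewrite ff1// mulrCA.
Qed.

Lemma Cm1_norm f : Cm1 f -> Cm1 (fun t => `|f t|).
Proof.
move=> /Cm1_formP[p [f1 [p1 cf1 ff1]]].
apply: (@Cm1_formW p (fun t => `|f1 t|)); split => //.
- move=> x; apply: (@continuous_comp _ _ _ f1 (fun y : R => `|y|)).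
    exact: cf1.
  exact: norm_continuous.
- by move=> t t0 /=; rewrite ff1// normrM (ger0_norm (powR_ge0 _ _)).
Qed.

Lemma Cm1_form_cst c : Cm1_form 0 (cst c) (cst c : R -> R).
Proof.
split; [by rewrite ltrN10 lexx|exact: cst_continuous|].
by move=> t t0; rewrite powRr0 mul1r.
Qed.

Lemma Cm1_continuous f t : Cm1 f -> 0 < t -> {for t, continuous f}.
Proof.
move=> /Cm1_formP[p [f1 [p1 cf1 ff1]]] t0.
have h : {for t, continuous (fun x => x `^ p * f1 x)}.
  apply: (@continuousM _ _ (@powR R ^~ p) f1); last exact: cf1.
  apply/differentiable_continuous/derivable1_diffP/derivable_powR.
  by rewrite in_itv/= t0.
move: h; rewrite /prop_for /continuous_at -ff1//.
apply: cvg_trans; apply: near_eq_cvg; near=> x.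
by rewrite ff1//; near: x; exact: lt_nbhsr.
Unshelve. all: by end_near. Qed.

End half_line_continuity.

(** * Affine changes of variables for the Lebesgue measure *)

Section lebesgue_affine.
Variable R : realType.
Notation mu := (@lebesgue_measure R).
Implicit Types (a b t : R).

Let affine a b : measurableTypeR R -> measurableTypeR R := fun x => a * x + b.

Let measurable_affine a b : measurable_fun setT (affine a b).
Proof.
by apply: measurable_funD => //; apply: measurable_funM.
Qed.

Let affine_preimage_itv a b u v : a != 0 ->
  (`|a|%:E * mu (affine a b @^-1` `]u, v]) = mu `]u, v])%E.
Proof.
move=> a0; have [a_gt0|a_lt0|/eqP] := ltgtP 0 a; last by
  rewrite eq_sym (negbTE a0).
- rewrite (_ : _ @^-1` _ = `](u - b) / a, (v - b) / a]%classic); last first.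
    apply/seteqP; split => x /=; rewrite !in_itv/= /affine;
    by rewrite ltr_pdivrMr// ler_pdivlMr// ltrBlDr lerBrDr mulrC.
  rewrite !lebesgue_measure_itv/= !lte_fin ltr_pM2r ?invr_gt0// ltrD2r.
  case: ifPn => _; last by rewrite mule0.
  rewrite -!EFinB -EFinM gtr0_norm//; congr (_%:E).
  by field.
(* A negative slope swaps the ends, and with them which end is closed; the length is unaffected. *)
- rewrite (_ : _ @^-1` _ = `[(v - b) / a, (u - b) / a[%classic); last first.
    apply/seteqP; split => x /=; rewrite !in_itv/= /affine;
    by rewrite ltr_ndivlMr// ler_ndivrMr// ltrBlDr lerBrDr mulrC andbC.
  rewrite !lebesgue_measure_itv/= !lte_fin ltr_nM2r ?invr_lt0// ltrD2r.
  case: ifPn => _; last by rewrite mule0.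
  rewrite -!EFinB -EFinM ltr0_norm//; congr (_%:E).
  by field.
Qed.

(** Both sides are measures in [A] that agree on half-open intervals, and these determine the
    Lebesgue measure. *)
Lemma lebesgue_measure_affine a b (A : set R) : a != 0 -> measurable A ->
  (`|a|%:E * mu ((fun x => a * x + b)%R @^-1` A) = mu A)%E.
Proof.
move=> a0 mA.
have := @lebesgue_measure_unique R
  (mscale (`|a|%:nng) (pushforward mu (affine a b))).
move=> /(_ _ (measurable_affine a b)) h; apply/esym/h => // _ [[u v]] _ <-.
exact/esym/affine_preimage_itv.
Qed.

Local Open Scope ereal_scope.

Lemma ge0_integral_affine a b (f : R -> \bar R) : a != 0%R ->
  measurable_fun [set: R] f -> (forall x, 0 <= f x) ->
  \int[mu]_x f x = `|a|%:E * \int[mu]_x f (a * x + b)%R.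
Proof.
move=> a0 mf f0.
have -> : \int[mu]_x f (a * x + b)%R =
    \int[mu]_(x in affine a b @^-1` setT) (f \o affine a b) x.
  by rewrite preimage_setT.
rewrite -(@ge0_integral_pushforward _ _ _ _ _ _
  (measurable_affine a b) mu setT)//.
rewrite -(@ge0_integral_mscale _ _ _ _ _ _ (`|a|%:nng)%R)//.
apply: eq_measure_integral => A mA _ /=.
exact/esym/lebesgue_measure_affine.
Qed.

Lemma integrable_affine a b (f : R -> \bar R) : a != 0%R ->
  mu.-integrable [set: R] f ->
  mu.-integrable [set: R] (fun x => f (a * x + b)%R).
Proof.
move=> a0 /integrableP[mf foo]; apply/integrableP; split.
  exact: (measurableT_comp mf (measurable_affine a b)).
move: foo; rewrite (@ge0_integral_affine a b)//; last exact: measurableT_comp.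
(* Writing [+oo] as [|a| * +oo] lets the positive factor cancel from the finiteness bound. *)
rewrite -[X in _ < X -> _](@gt0_muley _ `|a|%:E) ?lte_fin ?normr_gt0//.
by rewrite lte_pmul2l// lte_fin normr_gt0.
Qed.

Lemma integral_affine a b (f : R -> \bar R) : a != 0%R ->
  mu.-integrable [set: R] f ->
  \int[mu]_x f x = `|a|%:E * \int[mu]_x f (a * x + b)%R.
Proof.
move=> a0 fi; have gi := integrable_affine b a0 fi.
have mf := measurable_int mu fi.
pose g : measurableTypeR R -> \bar R := fun x => f (a * x + b)%R.
have -> : \int[mu]_x f (a * x + b)%R = \int[mu]_x g^\+ x - \int[mu]_x g^\- x.
  exact: integralE.
rewrite integralE muleBr//; last first.
  apply: fin_num_adde_defr; apply: integrable_fin_num => //.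
  exact: integrable_funepos.
have gp : forall x, g^\+ x = f^\+ (a * x + b)%R.
  by move=> x; rewrite !funeposE.
have gn : forall x, g^\- x = f^\- (a * x + b)%R.
  by move=> x; rewrite !funenegE.
rewrite (@ge0_integral_affine a b f^\+)//; last exact: measurable_funepos.
rewrite (@ge0_integral_affine a b f^\-)//; last exact: measurable_funeneg.
congr (_ * _ - _ * _).
  by apply: eq_integral => x _; rewrite gp.
by apply: eq_integral => x _; rewrite gn.
Qed.

End lebesgue_affine.

(** * Integrability of powers at the origin *)

Section powR_integrable.
Variable R : realType.
Notation mu := (@lebesgue_measure R).
Implicit Types (p q s t x : R).

Lemma integral_powR p s t : -1 < p -> 0 < s < t ->
  (\int[mu]_(x in `[s, t]) (x `^ p)%:E =
   ((t `^ (p + 1) - s `^ (p + 1)) / (p + 1))%:E)%E.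
Proof.
move=> p1 /andP[s0 st].
have p10 : 0 < p + 1 by rewrite -ltrBlDr sub0r.
have dF x : 0 < x ->
    is_derive x 1 (fun y => (p + 1)^-1 * y `^ (p + 1)) (x `^ p).
  move=> x0.
  have xoo : x \in `]0, +oo[ by rewrite in_itv/= x0.
  have dp : derivable (@powR R ^~ (p + 1)) x 1 by exact: derivable_powR.
  have := @is_deriveZ _ _ _ (@powR R ^~ (p + 1)) (p + 1)^-1 x 1 _
    (DeriveDef dp erefl).
  rewrite -derive1E powR_derive1// addrK /= scalerA mulVf ?gt_eqF// scale1r.
  exact.
have cF x : 0 < x -> {for x, continuous (fun y => (p + 1)^-1 * y `^ (p + 1))}.
  move=> x0; apply/differentiable_continuous/derivable1_diffP.
  by apply: ex_derive; exact: dF.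
have cp x : 0 < x -> {for x, continuous (@powR R ^~ p)}.
  move=> x0; apply/differentiable_continuous/derivable1_diffP/derivable_powR.
  by rewrite in_itv/= x0.
rewrite (@continuous_FTC2 _ (@powR R ^~ p) (fun y => (p + 1)^-1 * y `^ (p + 1)))//.
- by rewrite -EFinB -mulrBr mulrC.
- apply: continuous_in_subspaceT => x /[!inE]/=; rewrite in_itv/= => /andP[sx _].
  exact/cp/(lt_le_trans s0).
- split.
  + move=> x; rewrite in_itv/= => /andP[sx _].
    by apply: ex_derive; apply: dF; exact: lt_trans sx.
  + by apply: cvg_at_right_filter; exact: cF.
  + by apply: cvg_at_left_filter; apply: cF; exact: lt_trans st.
- move=> x; rewrite in_itv/= => /andP[sx _].
  by rewrite derive1E; apply: derive_val; apply: dF; exact: lt_trans sx.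
Qed.

Lemma integrable_powR p t : -1 < p ->
  mu.-integrable `]0, t[ (EFin \o (@powR R ^~ p)).
Proof.
move=> p1; have [t0|t0] := leP t 0.
  by rewrite set_itv_ge ?bnd_simp -?leNgt//; exact: integrable_set0.
have p10 : 0 < p + 1 by rewrite -ltrBlDr sub0r.
have mp D : measurable_fun D (fun x : R => (x `^ p)%:E).
  by apply/measurable_EFinP/measurable_funTS; exact: measurable_powR.
(* The shift to [n.+2] keeps the left end strictly below [t], as [integral_powR] demands. Monotone
   convergence along these segments carries the bound on their integrals over to the union. *)
pose F n : set (measurableTypeR R) := `[t / n.+2%:R, t]%classic.
have UF : `]0, t[ `<=` \bigcup_n F n.
  move=> x /=; rewrite in_itv/= => /andP[x0 xt].
  (* With [n] the integer part of [t / x], one has [t / x < n + 1 <= n + 2], hence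
     [t / (n + 2) <= x]. *)
  exists (Num.truncn (t / x)) => //; rewrite /F/= in_itv/= (ltW xt) andbT.
  rewrite ler_pdivrMr ?ltr0n// -ler_pdivrMl// mulrC.
  have /andP[_ /ltW h] := truncn_itv (divr_ge0 (ltW t0) (ltW x0)).
  by rewrite (le_trans h)// ler_nat.
suff : (\int[mu]_(x in \bigcup_n F n) (x `^ p)%:E <=
    (t `^ (p + 1) / (p + 1))%:E)%E.
  move=> foo.
  suff h : mu.-integrable (\bigcup_n F n) (EFin \o (@powR R ^~ p)).
    apply: integrableS h => //; apply: bigcup_measurable => n _.
    exact: measurable_itv.
  apply/integrableP; split; first exact: mp.
  apply: le_lt_trans (ltry (t `^ (p + 1) / (p + 1))).
  apply: le_trans foo; rewrite le_eqVlt; apply/orP; left; apply/eqP.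
  by apply: eq_integral => x _ /=; rewrite ger0_norm ?powR_ge0.
have ndF : nondecreasing_seq F.
  move=> m n mn; rewrite subsetEset; apply: subset_itvr; rewrite bnd_simp.
  by rewrite ler_pM2l// lef_pV2 ?posrE ?ltr0n// ler_nat.
have := @ge0_nondecreasing_set_cvg_integral _ _ _ F
  (fun x : measurableTypeR R => ((x : R) `^ p)%:E) mu ndF.
move=> /(_ (fun=> measurable_itv _) (fun=> mp _)) => /(_ _)/cvg_lim.
move=> <- //; last by move=> n x _; rewrite lee_fin powR_ge0.
apply: lime_le.
  apply: ereal_nondecreasing_is_cvgn.
  apply: ge0_nondecreasing_set_nondecreasing_integral => [//|n|n|n x _].
  - exact: measurable_itv.
  - exact: mp.
  - by rewrite lee_fin powR_ge0.
apply: nearW => n; rewrite integral_powR//; last first.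
  by rewrite divr_gt0 ?ltr0n// ltr_pdivrMr ?ltr0n// ltr_pMr// ltr1n.
by rewrite lee_fin ler_pM2r ?invr_gt0// gerBl powR_ge0.
Qed.

(** The reflection [x -> t - x] maps the interval to itself; it is applied to the power extended by
    0 outside. *)
Lemma integrable_powR_reflect p t : -1 < p ->
  mu.-integrable `]0, t[ (fun x => ((t - x) `^ p)%:E).
Proof.
move=> p1.
have h : mu.-integrable setT ((EFin \o (@powR R ^~ p)) \_ `]0, t[).
  by apply/integrable_restrict => //; rewrite setTI; exact: integrable_powR.
have := @integrable_affine R (-1) t _ _ h.
rewrite oppr_eq0 oner_eq0 => /(_ isT) {}h.
rewrite -(setTI `]0, t[%classic); apply/integrable_restrict => //.
apply: eq_integrable h => // x _.
rewrite !patchE !mem_setE.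
have -> : (-1 * x + t \in `]0, t[) = (x \in `]0, t[).
  by rewrite !in_itv/= mulN1r addrC subr_gt0 ltrBlDr ltrDl andbC.
by case: ifPn => // _ /=; rewrite mulN1r addrC.
Qed.

End powR_integrable.

(** * Laplace convolution *)

Section laplace_convolution.
Variable R : realType.
Notation mu := (@lebesgue_measure R).
Implicit Types (f g h : R -> R) (p q s t x : R).

Lemma continuous_bounded_segment f b : continuous f ->
  exists2 M, 0 <= M & forall x, 0 <= x <= b -> `|f x| <= M.
Proof.
move=> cf; have [b0|b0] := leP 0 b; last first.
  exists 0 => // x /andP[x0 xb]; move: (le_trans x0 xb).
  by rewrite leNgt b0.
have [|c _ fc] := @EVT_max R (fun x => `|f x|) 0 b b0.
  apply: continuous_subspaceT => x.
  apply: (@continuous_comp _ _ _ f (fun y : R => `|y|)); first exact: cf.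
  exact: norm_continuous.
by exists `|f c| => // x xb; apply: fc; rewrite in_itv.
Qed.

Lemma integrable_mul_bounded (D : set R) (A h : R -> R) (M : R) :
  measurable D -> mu.-integrable D (EFin \o A) -> measurable_fun D h ->
  (forall x, D x -> `|h x| <= M) ->
  mu.-integrable D (fun x => (A x * h x)%:E).
Proof.
move=> mD iA mh hM.
apply: (@le_integrable _ _ _ mu D mD _ (fun x => M%:E * (A x)%:E)%E).
- apply/measurable_EFinP/measurable_funM => //.
  apply/measurable_EFinP; exact: (measurable_int mu iA).
- move=> x Dx; rewrite -EFinM !abse_EFin lee_fin !normrM mulrC.
  by rewrite ler_wpM2r// (le_trans (hM _ Dx))// ler_norm.
- exact: integrableZl.
Qed.

(* On each half of the interval one of the two factors is bounded by its value
   at [t / 2]. *)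
Lemma integrable_beta p q t : -1 < p <= 0 -> -1 < q <= 0 ->
  mu.-integrable `]0, t[ (fun x => ((t - x) `^ p * x `^ q)%:E).
Proof.
move=> /andP[p1 p0] /andP[q1 q0]; have [t0|t0] := leP t 0.
  by rewrite set_itv_ge ?bnd_simp -?leNgt//; exact: integrable_set0.
have t20 : 0 < t / 2 by rewrite divr_gt0.
apply: (@le_integrable _ _ _ mu _ _ _
  (fun x => ((t / 2) `^ p)%:E * (x `^ q)%:E +
            ((t / 2) `^ q)%:E * ((t - x) `^ p)%:E)%E) => //.
- apply/measurable_EFinP/measurable_funM.
    apply: (@measurableT_comp _ _ _ _ _ _ (@powR R ^~ p)).
      exact: measurable_powR.
    exact: measurable_funB.
  by apply: measurable_funTS; exact: measurable_powR.
- move=> x /=; rewrite in_itv/= => /andP[x0 xt].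
  rewrite lee_fin !ger0_norm ?addr_ge0 ?mulr_ge0 ?powR_ge0//.
  have dec r (y z : R) : r <= 0 -> 0 < y <= z -> z `^ r <= y `^ r.
    move=> r0 /andP[y0 yz]; rewrite -(opprK r) !(powRN _ (- r)).
    rewrite lef_pV2 ?posrE ?powR_gt0 ?(lt_le_trans y0)//.
    by rewrite ge0_ler_powR ?oppr_ge0 ?nnegrE ?(ltW y0) ?(ltW (lt_le_trans y0 yz)).
  have [xt2|xt2] := leP x (t / 2).
    rewrite -[leLHS]addr0 lerD ?mulr_ge0 ?powR_ge0//.
    by rewrite ler_wpM2r ?powR_ge0// dec// t20/=; lra.
  rewrite -[leLHS]add0r lerD ?mulr_ge0 ?powR_ge0// mulrC.
  by rewrite ler_wpM2r ?powR_ge0// dec// t20/= ltW.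
- apply: integrableD => //; apply: integrableZl => //.
    exact: integrable_powR.
  exact: integrable_powR_reflect.
Qed.

(** With this extension by 0, convolutions are integrals over the whole line, a domain independent
    of [t], so that reflection, scaling and Fubini's theorem apply directly. *)
Definition causal f : R -> R := f \_ `]0, +oo[.

Lemma causalE f x : causal f x = if 0 < x then f x else 0.
Proof. by rewrite /causal patchE mem_setE in_itv/= andbT. Qed.

Lemma measurable_causal f : Cm1 f -> measurable_fun [set: R] (causal f).
Proof.
move=> /Cm1_formP[p [f1 [_ cf1 ff1]]]; apply/(measurable_restrictT _ _).1 => //.
apply: (@eq_measurable_fun _ _ _ _ _ (fun t => t `^ p * f1 t)).
  by move=> x; rewrite mem_setE in_itv/= andbT => x0; rewrite ff1.
apply: measurable_funTS; apply: measurable_funM; first exact: measurable_powR.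
exact: continuous_measurable_fun.
Qed.

Lemma lconv_integrandE f g t :
  (fun x => f (t - x) * g x) \_ `]0, t[ =
  (fun x => causal f (t - x) * causal g x).
Proof.
apply/funext => x; rewrite patchE mem_setE in_itv/= !causalE subr_gt0.
by case: (ltP 0 x) => _; case: (ltP x t) => _ //=; rewrite ?mulr0 ?mul0r.
Qed.

Lemma lconv_causal f g t :
  lconv f g t = \int[mu]_x (causal f (t - x) * causal g x).
Proof. by rewrite /lconv Rintegral_mkcond lconv_integrandE. Qed.

Lemma measurable_lconv_integrand f g t : Cm1 f -> Cm1 g ->
  measurable_fun [set: R] (fun x => causal f (t - x) * causal g x).
Proof.
move=> Cf Cg; apply: measurable_funM; last exact: measurable_causal.
apply: (measurableT_comp (measurable_causal Cf)).
exact: measurable_funB.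
Qed.

(** The integrand is the weight of [integrable_beta] times a continuous factor, bounded on the
    segment. *)
Lemma lconv_exP f g t : Cm1 f -> Cm1 g -> lconv_ex f g t.
Proof.
move=> Cf Cg; rewrite /lconv_ex.
have mfg : measurable_fun `]0, t[ (fun x => f (t - x) * g x).
  apply/(measurable_restrictT _ _).2 => //; rewrite lconv_integrandE.
  exact: measurable_lconv_integrand.
move: Cf Cg => /Cm1_formP[p [f1 [p1 cf1 ff1]]] /Cm1_formP[q [g1 [q1 cg1 gg1]]].
have [M M0 fM] := continuous_bounded_segment t cf1.
have [N N0 gN] := continuous_bounded_segment t cg1.
have mfg1 : measurable_fun `]0, t[ (fun x => f1 (t - x) * g1 x).
  apply: measurable_funM; last first.
    by apply: measurable_funTS; exact: continuous_measurable_fun.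
  apply: measurable_funTS.
  apply: (measurableT_comp (continuous_measurable_fun cf1)).
  exact: measurable_funB.
have bfg1 x : `]0, t[%classic x -> `|f1 (t - x) * g1 x| <= M * N.
  rewrite /= in_itv/= => /andP[x0 xt].
  rewrite normrM ler_pM// ?fM ?gN// ?(ltW x0) ?(ltW xt)//.
  by rewrite subr_ge0 gerBl !ltW.
have mI : measurable (`]0, t[%classic : set R) by exact: measurable_itv.
have := integrable_mul_bounded mI (integrable_beta t p1 q1) mfg1 bfg1.
apply: eq_integrable => // x; rewrite mem_setE in_itv/= => /andP[x0 xt].
by rewrite ff1 ?subr_gt0// gg1//; congr _%:E; ring.
Qed.

Lemma integrable_lconv f g t : Cm1 f -> Cm1 g ->
  mu.-integrable [set: R] (fun x => (causal f (t - x) * causal g x)%:E).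
Proof.
move=> Cf Cg; have := lconv_exP t Cf Cg; rewrite /lconv_ex.
rewrite -(setTI `]0, t[%classic) => /integrable_restrict.
by rewrite -[X in X \_ _]/(EFin \o _) restrict_EFin lconv_integrandE; apply.
Qed.

Lemma lconv_le0 f g t : t <= 0 -> lconv f g t = 0.
Proof.
by move=> t0; rewrite /lconv set_itv_ge ?Rintegral_set0// bnd_simp -leNgt.
Qed.

Lemma eq_lconv f f' g g' :
  (forall t, 0 < t -> f t = f' t) -> (forall t, 0 < t -> g t = g' t) ->
  lconv f g = lconv f' g'.
Proof.
move=> ff gg; apply/funext => t; apply: eq_Rintegral => x.
by rewrite mem_setE in_itv/= => /andP[x0 xt]; rewrite ff ?subr_gt0// gg.
Qed.

(** Convolutions vanish for [t <= 0], where the interval is empty. Identities on the half-line thus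
    become equalities of functions, usable for rewriting. *)
Lemma lconv_fun_eq f g f' g' :
  (forall t, 0 < t -> lconv f g t = lconv f' g' t) -> lconv f g = lconv f' g'.
Proof.
move=> fg; apply/funext => t; have [t0|t0] := leP t 0; last exact: fg.
by rewrite !lconv_le0.
Qed.

Lemma causal_lconv f g : causal (lconv f g) = lconv f g.
Proof.
apply/funext => t; rewrite causalE; case: ltP => // t0.
by rewrite lconv_le0.
Qed.

(** The substitution [x -> t - x] exchanges the two factors. *)
Lemma lconvC f g : Cm1 f -> Cm1 g -> lconv f g = lconv g f.
Proof.
move=> Cf Cg; apply/funext => t; rewrite !lconv_causal; congr fine.
have := @integral_affine R (-1) t _ _ (integrable_lconv t Cf Cg).
rewrite oppr_eq0 oner_eq0 => /(_ isT) ->.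
rewrite normrN1 mul1e; apply: eq_integral => x _.
by rewrite mulN1r [- x + t]addrC subKr mulrC.
Qed.

Lemma lconvDl f g h : Cm1 f -> Cm1 g -> Cm1 h ->
  lconv (f \+ g) h = lconv f h \+ lconv g h.
Proof.
move=> Cf Cg Ch; apply/funext => t; rewrite /lconv.
under eq_Rintegral do rewrite mulrDl.
by rewrite RintegralD//; exact: lconv_exP.
Qed.

Lemma lconvZl c f g : Cm1 f -> Cm1 g ->
  lconv (fun t => c * f t) g = (fun t => c * lconv f g t).
Proof.
move=> Cf Cg; apply/funext => t; rewrite /lconv.
under eq_Rintegral do rewrite -mulrA.
by rewrite RintegralZl//; exact: lconv_exP.
Qed.

End laplace_convolution.

(** * Closure under convolution, and associativity *)

Section laplace_convolution_ring.
Variable R : realType.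
Notation mu := (@lebesgue_measure R).
Implicit Types (f g h : R -> R) (p q s t x y : R).

(** What remains of a convolution after the scaling [x = t * s], once [t ^ (p + q + 1)] is taken
    out: the singular weight no longer depends on [t]. *)
Definition beta_average p q f g (t : R) : R :=
  \int[mu]_(s in `]0, 1[)
     ((1 - s) `^ p * s `^ q * (f (t * (1 - s)) * g (t * s))).

Let measurable_comp_affine f (a b : R) : continuous f ->
  measurable_fun [set: R] (fun s => f (a * s + b)).
Proof.
move=> cf; apply: (measurableT_comp (continuous_measurable_fun cf)).
by apply: measurable_funD => //; exact: measurable_funM.
Qed.

Let measurable_average_factor f g t : continuous f -> continuous g ->
  measurable_fun (`]0, 1[ : set R) (fun s => f (t * (1 - s)) * g (t * s)).
Proof.
move=> cf cg; apply: measurable_funTS; apply: measurable_funM.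
- rewrite (_ : (fun s => _) = (fun s => f (- t * s + t))).
    exact: measurable_comp_affine.
  by apply/funext => s; congr f; ring.
- rewrite (_ : (fun s => _) = (fun s => g (t * s + 0))).
    exact: measurable_comp_affine.
  by apply/funext => s; rewrite addr0.
Qed.

(** The bound is uniform in [t] over [[0, b]], as domination under the integral sign requires. *)
Let average_factor_bound f g b : continuous f -> continuous g ->
  exists M : R, forall t s, 0 <= t <= b -> 0 < s < 1 ->
  `|f (t * (1 - s)) * g (t * s)| <= M.
Proof.
move=> cf cg.
have [M M0 fM] := continuous_bounded_segment b cf.
have [N N0 gN] := continuous_bounded_segment b cg.
exists (M * N) => t s /andP[t0 tb] /andP[s0 s1].
rewrite normrM ler_pM// ?fM ?gN//.
- rewrite mulr_ge0 ?subr_ge0 ?(ltW s1)//= (le_trans _ tb)//.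
  by rewrite ler_piMr// gerBl ltW.
- by rewrite mulr_ge0 ?(ltW s0)//= (le_trans _ tb)// ler_piMr// ltW.
Qed.

Lemma integrable_beta_average p q f g t :
  -1 < p <= 0 -> -1 < q <= 0 -> continuous f -> continuous g -> 0 <= t ->
  mu.-integrable `]0, 1[ (fun s =>
    ((1 - s) `^ p * s `^ q * (f (t * (1 - s)) * g (t * s)))%:E).
Proof.
move=> p1 q1 cf cg t0.
have [M fgM] := average_factor_bound t cf cg.
have mI : measurable (`]0, 1[%classic : set R) by exact: measurable_itv.
apply: (@integrable_mul_bounded R _ _ _ M mI (integrable_beta 1 p1 q1)).
  exact: measurable_average_factor.
by move=> s /=; rewrite in_itv/= => s01; apply: fgM => //; rewrite t0 lexx.
Qed.

Lemma continuous_beta_average p q f g :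
  -1 < p <= 0 -> -1 < q <= 0 -> continuous f -> continuous g ->
  continuous (fun t => beta_average p q f g (Num.max 0 t)).
Proof.
move=> p1 q1 cf cg t.
(* On the neighbourhood [](t - 1), b[] of [t], the values [max 0 x] stay in [[0, b]], so one
   dominating function suffices. *)
pose b := Num.max 0 t + 1.
have [M fgM] := average_factor_bound b cf cg.
have mI : measurable (`]0, 1[%classic : set R) by exact: measurable_itv.
have max0_le x : x < b -> 0 <= Num.max 0 x <= b.
  move=> xb; rewrite le_max lexx/= ge_max (ltW xb) andbT.
  by rewrite addr_ge0// le_max lexx.
have tb : t \in `](t - 1), b[.
  rewrite in_itv/= gtrBl ltr01/=.
  by rewrite (@le_lt_trans _ _ (Num.max 0 t)) ?ltrDl// le_max lexx orbT.
have := @continuity_under_integral R _ _ mu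
  (fun x s => (1 - s) `^ p * s `^ q *
     (f (Num.max 0 x * (1 - s)) * g (Num.max 0 x * s)))
  `]0, 1[%classic mI (t - 1) b.
have ccont s : continuous (fun x => (1 - s) `^ p * s `^ q *
    (f (Num.max 0 x * (1 - s)) * g (Num.max 0 x * s))).
  have cmul c : continuous (fun x => Num.max 0 x * c).
    move=> x; apply: (@continuousM _ _ (fun x => Num.max 0 x) (cst c)).
      exact: continuous_max0.
    exact: cst_continuous.
  move=> x; apply: (@continuousM _ _ (cst ((1 - s) `^ p * s `^ q))
    (fun x => f (Num.max 0 x * (1 - s)) * g (Num.max 0 x * s))); first
    exact: cst_continuous.
  apply: (@continuousM _ _ (fun x => f (Num.max 0 x * (1 - s)))
    (fun x => g (Num.max 0 x * s))).
    exact: (continuous_comp (cmul _ _) (cf _)).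
  exact: (continuous_comp (cmul _ _) (cg _)).
have iM : mu.-integrable `]0, 1[ (fun s => ((1 - s) `^ p * s `^ q * M)%:E).
  exact: (@integrable_mul_bounded R _ _ _ `|M| mI (integrable_beta 1 p1 q1)).
apply => //.
- move=> x _; apply: integrable_beta_average => //.
  by rewrite le_max lexx.
- by apply: aeW => s _ x _; exact: ccont.
- exact: iM.
- move=> x /=; rewrite in_itv/= => /andP[_ xb]; apply: aeW => s /=.
  rewrite in_itv/= => s01.
  rewrite normrM ger0_norm ?mulr_ge0 ?powR_ge0//.
  by rewrite ler_wpM2l ?mulr_ge0 ?powR_ge0// fgM// max0_le.
- by rewrite mem_setE.
Qed.

Lemma lconv_beta_average p q f1 g1 f g t :
  Cm1_form p f1 f -> Cm1_form q g1 g -> 0 < t ->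
  lconv f g t = t `^ (p + q + 1) * beta_average p q f1 g1 t.
Proof.
move=> fP gP t0; rewrite lconv_causal.
have ifg := integrable_lconv t (Cm1_formW fP) (Cm1_formW gP).
have t_neq0 : t != 0 by rewrite gt_eqF.
have iaff := integrable_affine 0 t_neq0 ifg.
rewrite [LHS]/Rintegral (integral_affine 0 t_neq0 ifg) gtr0_norm//.
rewrite fineM//; last exact: integrable_fin_num iaff.
move: fP gP => [p1 cf1 ff1] [q1 cg1 gg1].
(* The factor [t] is the Jacobian of the scaling; [t ^ (p + q)] comes from the two powers. *)
have -> : t `^ (p + q + 1) = t * t `^ (p + q).
  by rewrite powRD ?(gt_eqF t0) ?implybT// powRr1 ?ltW// mulrC.
rewrite -mulrA /beta_average -RintegralZl//; last first.
  by apply: integrable_beta_average => //; exact: ltW.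
rewrite /= Rintegral_mkcond; congr (_ * fine _); apply: eq_integral => s _.
congr _%:E; rewrite patchE mem_setE in_itv/= !causalE addr0.
have -> : (0 < t - t * s) = (s < 1).
  by rewrite subr_gt0 -[X in _ < X]mulr1 ltr_pM2l.
rewrite pmulr_rgt0//.
have [s0|s0] := ltP 0 s; last by rewrite mulr0.
have [s1|s1] := ltP s 1; last by rewrite mul0r.
have -> : t - t * s = t * (1 - s) by ring.
rewrite ff1 ?mulr_gt0 ?subr_gt0// gg1 ?mulr_gt0//.
rewrite (powRM p (ltW t0)) ?subr_ge0 ?(ltW s1)// (powRM q (ltW t0)) ?(ltW s0)//.
by rewrite powRD ?(gt_eqF t0) ?implybT//=; ring.
Qed.

Lemma lconv_form p q f1 g1 f g :
  Cm1_form p f1 f -> Cm1_form q g1 g ->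
  exists2 phi, continuous phi &
    forall t, 0 < t -> lconv f g t = t `^ (p + q + 1) * phi t.
Proof.
move=> fP gP; exists (fun t => beta_average p q f1 g1 (Num.max 0 t)).
  by case: fP gP => [? ? _] [? ? _]; exact: continuous_beta_average.
move=> t t0; rewrite (max_idPr (ltW t0)).
exact: lconv_beta_average.
Qed.

Lemma Cm1_lconv f g : Cm1 f -> Cm1 g -> Cm1 (lconv f g).
Proof.
move=> /Cm1_formP[p [f1 fP]] /Cm1_formP[q [g1 gP]].
have [phi cphi fgE] := lconv_form fP gP.
exists (p + q + 1), phi; split => //; last exact: continuous_subspaceT.
by case: fP gP => [/andP[p1 _] _ _] [/andP[q1 _] _ _]; lra.
Qed.

Let norm_causal f x : causal (fun t => `|f t|) x = `|causal f x|.
Proof. by rewrite !causalE; case: ifP => // _; rewrite normr0. Qed.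

(** Displays a triple convolution as an iterated integral in the extended reals, the form in which
    Fubini's theorem applies. *)
Lemma lconv_iterated f g h t : Cm1 f -> Cm1 g ->
  lconv (lconv f g) h t =
  fine (\int[mu]_x \int[mu]_y
     (causal f (t - x - y) * causal g y * causal h x)%:E)%E.
Proof.
move=> Cf Cg; rewrite lconv_causal; congr fine; apply: eq_integral => x _.
rewrite causal_lconv lconv_causal.
under [RHS]eq_integral do rewrite EFinM.
rewrite integralZr//; last exact: integrable_lconv.
rewrite EFinM fineK//; apply: integrable_fin_num => //.
exact: integrable_lconv.
Qed.

(* Both sides are iterated integrals of [f(t - x - y) g(y) h(x)], so Fubini's
   theorem applies without any change of variables. *)
Lemma lconvAC f g h : Cm1 f -> Cm1 g -> Cm1 h ->
  lconv (lconv f g) h = lconv (lconv f h) g.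
Proof.
move=> Cf Cg Ch; apply/funext => t.
rewrite (lconv_iterated h t Cf Cg) (lconv_iterated g t Cf Ch); congr fine.
pose F (z : R * R) :=
  (causal f (t - z.1 - z.2) * causal g z.2 * causal h z.1)%:E.
transitivity (\int[mu]_x \int[mu]_y F (x, y))%E; first by [].
rewrite (@Fubini _ _ _ _ R mu mu F).
  apply: eq_integral => y _; apply: eq_integral => x _.
  by rewrite /F/= addrAC mulrAC.
have mF : measurable_fun setT F.
  apply/measurable_EFinP; apply: measurable_funM; last first.
    exact: (measurableT_comp (measurable_causal Ch)).
  apply: measurable_funM; last first.
    exact: (measurableT_comp (measurable_causal Cg)).
  apply: (measurableT_comp (measurable_causal Cf)).
  by apply: measurable_funB => //; exact: measurable_funB.
apply/integrable12ltyP => //.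
(* The iterated integral of the absolute value is the triple convolution of [|f|], [|g|] and [|h|],
   which is finite. *)
have := integrable_lconv t (Cm1_lconv (Cm1_norm Cf) (Cm1_norm Cg)) (Cm1_norm Ch).
move=> /integrableP[_]; apply: le_lt_trans.
rewrite le_eqVlt; apply/orP; left; apply/eqP; apply: eq_integral => x _.
rewrite causal_lconv lconv_causal norm_causal.
under eq_integral do rewrite /F/= !normrM EFinM.
rewrite integralZr//; last first.
  have := integrable_lconv (t - x) (Cm1_norm Cf) (Cm1_norm Cg).
  by apply: eq_integrable => // y _; rewrite !norm_causal.
rewrite /= normrM normr_id EFinM; congr (_ * _)%E.
rewrite ger0_norm; last first.
  by apply: Rintegral_ge0 => y _; rewrite !norm_causal mulr_ge0.
rewrite fineK.
  by apply: eq_integral => y _; rewrite !norm_causal.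
apply: integrable_fin_num => //; apply: integrable_lconv; exact: Cm1_norm.
Qed.

Lemma lconvA f g h : Cm1 f -> Cm1 g -> Cm1 h ->
  lconv f (lconv g h) = lconv (lconv f g) h.
Proof.
move=> Cf Cg Ch; rewrite (lconvC Cf (Cm1_lconv Cg Ch)) (lconvAC Cg Ch Cf).
by rewrite (lconvC Cg Cf).
Qed.

End laplace_convolution_ring.

(** * Convolution with 1, primitives and cancellation *)

Section primitive.
Variable R : realType.
Notation mu := (@lebesgue_measure R).
Implicit Types (f g h k : R -> R) (p q s t x y : R).

Lemma Cm1_cst (c : R) : Cm1 (cst c : R -> R).
Proof. exact: Cm1_formW (Cm1_form_cst c). Qed.

(** Convolution with 1 is integration from 0, so this is the fundamental theorem of calculus at a
    point of continuity. *)
Lemma derive_lconv1 h t : Cm1 h -> 0 < t ->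
  derivable (lconv (cst 1) h) t 1 /\ derive1 (lconv (cst 1) h) t = h t.
Proof.
move=> Ch t0.
have ih u : mu.-integrable `]0, u[ (EFin \o h).
  have := lconv_exP u (Cm1_cst 1) Ch; apply: eq_integrable => // x _ /=.
  by rewrite mul1r.
have -> : lconv (cst 1) h = (fun y => \int[mu]_(x in `]0, y]) h x).
  apply/funext => y; rewrite -Rintegral_itv_bndo_bndc//.
  by apply: eq_Rintegral => x _; rewrite mul1r.
apply: (@continuous_FTC1 R h (BRight 0) t (t + 1)).
- by rewrite ltrDl.
(* Integrability is known on open intervals; []0, t + 2[] contains the half-closed []0, t + 1]]. *)
- apply: integrableS (ih (t + 2)) => //.
  by apply: subset_itvl; rewrite bnd_simp ltrD2l ltr1n.
- by [].
- exact: Cm1_continuous.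
Qed.

Lemma lconv1_inj g h : Cm1 g -> Cm1 h -> lconv (cst 1) g = lconv (cst 1) h ->
  forall t, 0 < t -> g t = h t.
Proof.
move=> Cg Ch gh t t0.
by rewrite -(derive_lconv1 Cg t0).2 gh (derive_lconv1 Ch t0).2.
Qed.

(** The difference of [g] and the primitive of its derivative has derivative 0, so it is constant by
    the mean value theorem; its value at 1 serves as [c]. *)
Lemma lconv_primitive g :
  (forall t, 0 < t -> derivable g t 1) -> Cm1 (derive1 g) ->
  exists c, forall t, 0 < t -> g t = c + lconv (cst 1) (derive1 g) t.
Proof.
move=> dg Cg'; set G := lconv (cst 1) (derive1 g).
have dG t : 0 < t -> is_derive t 1 (g \- G) 0.
  move=> t0; have [dGt G't] := derive_lconv1 Cg' t0.
  have -> : 0 = derive1 g t - derive1 G t by rewrite G't subrr.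
  have dgt : is_derive t 1 g (derive1 g t).
    by rewrite derive1E; exact: DeriveDef (dg t t0) erefl.
  have dGt' : is_derive t 1 G (derive1 G t).
    by rewrite derive1E; exact: DeriveDef dGt erefl.
  exact: (@is_deriveB _ _ _ g G t 1 _ _ dgt dGt').
have cst_le a b : 0 < a -> a < b -> (g \- G) b = (g \- G) a.
  move=> a0 ab.
  have [||c _] := @MVT R (g \- G) (cst 0) a b ab.
  - by move=> x; rewrite in_itv/= => /andP[ax _]; apply: dG; exact: lt_trans ax.
  - apply: derivable_within_continuous => x; rewrite in_itv/= => /andP[ax _].
    by apply: ex_derive; apply: dG; exact: lt_le_trans ax.
  - by rewrite mul0r => /eqP; rewrite subr_eq0 => /eqP.
exists ((g \- G) 1) => t t0.
suff <- : (g \- G) t = (g \- G) 1 by rewrite /= subrK.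
by have [t1|t1|->//] := ltgtP t 1; [rewrite [RHS](cst_le t)|exact: cst_le].
Qed.

(** The constant 1 has exponent 0 and [h] some [q > -1], so the convolution carries the positive
    power [q + 1], which vanishes at 0. *)
Lemma lconv1_form h : Cm1 h -> exists2 G, continuous G &
  G 0 = 0 /\ forall t, 0 < t -> lconv (cst 1) h t = G t.
Proof.
move=> /Cm1_formP[q [h1 hP]].
have [phi cphi hE] := lconv_form (Cm1_form_cst 1) hP.
have q10 : 0 < 0 + q + 1 by case: hP => /andP[q1 _] _ _; lra.
exists (fun t => Num.max 0 t `^ (0 + q + 1) * phi t).
  move=> x; apply: (@continuousM _ _ (fun t => Num.max 0 t `^ (0 + q + 1)) phi).
    exact: (continuous_powR_max0 (ltW q10)).
  exact: cphi.
split; first by rewrite maxxx powR0 ?mul0r// gt_eqF.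
by move=> t t0; rewrite (max_idPr (ltW t0)) hE.
Qed.

(** Since the primitive of [GFD k f] tends to 0 at 0, the constant of [lconv_primitive] is the limit
    of [GFI k f] there. *)
Lemma GFI_primitive k f : C1m1 k f ->
  C0_ext (GFI k f) /\
  forall t, 0 < t -> GFI k f t = GFI_at0 k f + lconv (cst 1) (GFD k f) t.
Proof.
move=> [Cf dkf CD]; have [c gE] := lconv_primitive dkf CD.
have [G cG [G0 GE]] := lconv1_form CD.
have cc : continuous (fun t => c + G t).
  by move=> x; apply: (@continuousD _ _ _ (cst c) G);
    [exact: cst_continuous|exact: cG].
have gG t : 0 < t -> GFI k f t = c + G t by move=> t0; rewrite gE// GE.
split.
  by exists (fun t => c + G t); split=> //; exact: continuous_subspaceT.
suff -> : GFI_at0 k f = c by exact: gE.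
suff h : GFI k f t @[t --> 0^'+] --> c by exact: cvg_lim h.
have h : c + G t @[t --> 0^'+] --> c.
  by have := cvg_at_right_filter (cc 0); rewrite G0 addr0.
apply: cvg_trans h; apply: near_eq_cvg; near=> t.
rewrite gG//; near: t; exact: nbhs_right_gt.
Unshelve. all: by end_near. Qed.

Lemma lconv0l f : lconv (cst 0) f = cst 0.
Proof.
apply/funext => t; rewrite /lconv; under eq_Rintegral do rewrite mul0r.
by rewrite Rintegral_cst// mul0r.
Qed.

(** Convolving further with [v] replaces [u] by 1, and convolution with 1 is injective. *)
Lemma lconv_unit_cancel u v g h : Cm1 u -> Cm1 v -> Cm1 g -> Cm1 h ->
  (forall t, 0 < t -> lconv u v t = 1) -> lconv g u = lconv h u ->
  forall t, 0 < t -> g t = h t.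
Proof.
move=> Cu Cv Cg Ch uv1 gh.
have E (x : R -> R) : Cm1 x -> lconv (cst 1) x = lconv (lconv x u) v.
  move=> Cx; rewrite -(lconvC Cu Cx) -(lconvAC Cu Cv Cx).
  by apply: eq_lconv => // t t0; rewrite uv1.
by apply: (lconv1_inj Cg Ch); rewrite (E g Cg) (E h Ch) gh.
Qed.

End primitive.

(** * Convolution quotients *)

Section convolution_quotients.
Variable R : realType.
Implicit Types (f g h x y z : R -> R) (A B : cquot R).

#[local] Hint Resolve Cm1_lconv Cm1D Cm1Z : core.

Lemma cequivP (p q : (R -> R) * (R -> R)) :
  cequiv p q <-> lconv p.1 q.2 = lconv q.1 p.2.
Proof. by split=> [/lconv_fun_eq//|pq t _]; rewrite pq. Qed.

Lemma cfrac_eq f g h : (forall t, 0 < t -> f t = g t) -> cfrac f h = cfrac g h.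
Proof.
move=> fg; apply/funext => p; apply/propext; rewrite /cfrac /= /cequiv /=.
by rewrite (eq_lconv fg (fun t _ => erefl (p.2 t))).
Qed.

Variables kappa v : R -> R.
Hypotheses (Ck : Cm1 kappa) (Cv : Cm1 v)
  (kv1 : forall t, 0 < t -> lconv kappa v t = 1).

(** The function [v], later [lconv k1 k2], is what makes [kappa] cancellable. *)
Let cancel_kappa f g : Cm1 f -> Cm1 g -> lconv f kappa = lconv g kappa ->
  forall t, 0 < t -> f t = g t.
Proof. by move=> Cf Cg; exact: (lconv_unit_cancel Ck Cv Cf Cg kv1). Qed.

(** Applied backwards, this inserts a factor [kappa] into a goal, so that the equations defining the
    representatives can be rewritten in it. *)
Let cancel_lconv f f' g g' : Cm1 f -> Cm1 f' -> Cm1 g -> Cm1 g' ->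
  lconv (lconv f f') kappa = lconv (lconv g g') kappa ->
  lconv f f' = lconv g g'.
Proof.
by move=> Cf Cf' Cg Cg' fg; apply: lconv_fun_eq; apply: cancel_kappa fg; auto.
Qed.

Let neq0_exists f : (~ forall t, 0 < t -> f t = 0) ->
  exists2 t, 0 < t & f t != 0.
Proof.
move=> f0; apply: contrapT => nf; apply: f0 => t t0.
by apply/eqP; apply: contrapT => /negP ft; apply: nf; exists t.
Qed.

Let kappa_neq0 : exists2 t, 0 < t & kappa t != 0.
Proof.
apply: neq0_exists => k0.
have := kv1 ltr01.
rewrite (eq_lconv (f' := cst 0) (g' := v))// lconv0l => /esym/eqP.
by rewrite oner_eq0.
Qed.

(** If [kappa * kappa] vanished, cancelling one factor would give [kappa = 0]. *)
Let kappa2_neq0 : exists2 t, 0 < t & lconv kappa kappa t != 0.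
Proof.
apply: neq0_exists => k0.
have [t t0 /eqP] := kappa_neq0; apply; move: t t0.
change (forall t, 0 < t -> kappa t = cst 0 t).
apply: cancel_kappa => //; first exact: Cm1_cst.
by rewrite lconv0l; apply/funext => t; have [t0|t0] := leP t 0;
  [rewrite lconv_le0|rewrite k0].
Qed.

Let mem_cfrac f g : Cm1 f -> Cm1 g -> (exists2 t, 0 < t & g t != 0) ->
  cfrac f g (f, g).
Proof. by move=> Cf Cg g0; split => //; apply/cequivP. Qed.

(* Here and in the two lemmas below, the representatives with denominator
   [kappa] or [kappa * kappa] give the right-hand side, and the sets given by
   all the other representatives contain it. *)
Lemma cq_mul_S_emb f : Cm1 f ->
  cq_mul (cq_S kappa) (cq_emb kappa f) = cfrac f kappa.
Proof.
move=> Cf; apply/seteqP; split => [p|p [Cp /cequivP /= pE]].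
  move=> /(_ (kappa, lconv kappa kappa)).
  move=> /(_ (mem_cfrac Ck (Cm1_lconv Ck Ck) kappa2_neq0)).
  move=> /(_ (lconv f kappa, kappa)).
  move=> /(_ (mem_cfrac (Cm1_lconv Cf Ck) Ck kappa_neq0)) [Cp /cequivP /= pE].
  split => //; apply/cequivP => /=; case: Cp => Cp1 Cp2 _.
  (* Up to reordering, [pE] is the goal convolved twice with [kappa]. *)
  do 2 (apply: cancel_lconv; [by auto..|]).
  have Cfk := Cm1_lconv Cf Ck.
  move: pE; rewrite (lconvA Cp1 (Cm1_lconv Ck Ck) Ck) (lconvA Cp1 Ck Ck) => ->.
  rewrite (lconvA Ck Cf Ck) (lconvC Ck Cf) (lconvAC Cfk Ck Cp2).
  by rewrite (lconvAC Cf Ck Cp2).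
case: (Cp) => Cp1 Cp2 _ a [[Ca1 Ca2 _] /cequivP /= aE].
move=> b [[Cb1 Cb2 _] /cequivP /= bE].
split => //; apply/cequivP => /=.
(* Every representative of [cq_S kappa] has denominator [a.1 * kappa]: cancel one [kappa] in
   [a.1 * (kappa * kappa) = kappa * a.2]. *)
have {}aE t : 0 < t -> a.2 t = lconv a.1 kappa t.
  apply: cancel_kappa t; [by []|by auto|].
  by rewrite (lconvC Ca2 Ck) -aE lconvA.
rewrite (eq_lconv aE (fun t _ => erefl (b.2 t))).
apply: cancel_lconv; [by auto..|].
have Ca1k := Cm1_lconv Ca1 Ck.
have Cfp := Cm1_lconv Cf Cp2.
have Cfa := Cm1_lconv Cf Ca1.
rewrite (lconvAC Cp1 (Cm1_lconv Ca1k Cb2) Ck) pE.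
rewrite (lconvAC (Cm1_lconv Ca1 Cb1) Cp2 Ck) -(lconvA Ca1 Cb1 Ck) bE.
rewrite (lconvA Cfp Ca1k Cb2) (lconvA Cfp Ca1 Ck).
rewrite (lconvA Ca1 (Cm1_lconv Cf Ck) Cb2) (lconvA Ca1 Cf Ck) (lconvC Ca1 Cf).
rewrite (lconvAC (Cm1_lconv Cfa Ck) Cb2 Cp2) (lconvAC Cfa Ck Cp2).
by rewrite (lconvAC Cf Ca1 Cp2).
Qed.

Lemma cq_scale_cfrac c f : Cm1 f ->
  cq_scale c (cfrac f kappa) = cfrac (fun t => c * f t) kappa.
Proof.
move=> Cf; apply/seteqP; split => [p|p [Cp /cequivP /= pE]].
  by move=> /(_ (f, kappa)); apply; exact: mem_cfrac.
case: (Cp) => Cp1 Cp2 _ a [[Ca1 Ca2 _] /cequivP /= aE].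
split => //; apply/cequivP => /=.
apply: cancel_lconv; [by auto..|].
rewrite (lconvAC Cp1 Ca2 Ck) pE (lconvAC (Cm1Z c Ca1) Cp2 Ck).
rewrite (lconvZl c Ca1 Ck) aE -(lconvZl c Cf Ca2).
by rewrite (lconvAC (Cm1Z c Cf) Cp2 Ca2).
Qed.

Lemma cq_add_cfrac f g : Cm1 f -> Cm1 g ->
  cq_add (cfrac f kappa) (cfrac g kappa) = cfrac (f \+ g) kappa.
Proof.
move=> Cf Cg; apply/seteqP; split => [p|p [Cp /cequivP /= pE]].
  move=> /(_ (f, kappa) (mem_cfrac Cf Ck kappa_neq0)).
  move=> /(_ (g, kappa) (mem_cfrac Cg Ck kappa_neq0)) [Cp /cequivP /= pE].
  split => //; apply/cequivP => /=; case: Cp => Cp1 Cp2 _.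
  apply: cancel_lconv; [by auto..|].
  rewrite -(lconvA Cp1 Ck Ck) pE -(lconvDl Cf Cg Ck).
  by rewrite (lconvAC (Cm1D Cf Cg) Ck Cp2).
case: (Cp) => Cp1 Cp2 _ a [[Ca1 Ca2 _] /cequivP /= aE].
move=> b [[Cb1 Cb2 _] /cequivP /= bE].
split => //; apply/cequivP => /=.
apply: cancel_lconv; [by auto..|].
have Cfg := Cm1D Cf Cg.
have Cab := Cm1_lconv Ca1 Cb2.
have Cba := Cm1_lconv Cb1 Ca2.
rewrite (lconvAC Cp1 (Cm1_lconv Ca2 Cb2) Ck) pE.
rewrite (lconvAC (Cm1D Cab Cba) Cp2 Ck) (lconvDl Cab Cba Ck).
rewrite (lconvAC Ca1 Cb2 Ck) (lconvAC Cb1 Ca2 Ck) aE bE.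
rewrite (lconvAC Cg Cb2 Ca2).
rewrite -(lconvDl (Cm1_lconv Cf Ca2) (Cm1_lconv Cg Ca2) Cb2).
rewrite -(lconvDl Cf Cg Ca2) (lconvA (Cm1_lconv Cfg Cp2) Ca2 Cb2).
rewrite (lconvAC Cfg Cp2 Ca2).
by rewrite (lconvAC (Cm1_lconv Cfg Ca2) Cp2 Cb2).
Qed.

End convolution_quotients.

(** * The 1st level derivative as a convolution quotient *)

Lemma C1m1_equation (R : realType) (kappa k1 k2 f : R -> R) :
  L11 kappa k1 k2 -> C1m1 k2 f -> forall t, 0 < t ->
  lconv (GFD1 k1 k2 f) kappa t = f t - P1L kappa k1 k2 f t.
Proof.
move=> [Ck C1 C2 k1E] hf; have [_ gE] := GFI_primitive hf.
case: (hf) => Cf _ CD.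
have Ck1 : Cm1 (lconv kappa k1) by exact: Cm1_lconv.
have CkD : Cm1 (lconv k1 (GFD k2 f)) by exact: Cm1_lconv.
have CP : Cm1 (P1L kappa k1 k2 f) by exact: Cm1Z.
have CfP : Cm1 (f \+ (fun t => -1 * P1L kappa k1 k2 f t)).
  by apply: Cm1D => //; exact: Cm1Z.
have k2E t : 0 < t -> lconv k2 (lconv kappa k1) t = 1.
  by move=> t0; rewrite (lconvC C2 Ck1) k1E.
(* The difference is written as a sum with a multiple by -1, to which [lconvDl] and [lconvZl]
   apply. *)
suff E t : 0 < t ->
    lconv (GFD1 k1 k2 f) kappa t = (f \+ (fun t => -1 * P1L kappa k1 k2 f t)) t.
  by move=> t t0; rewrite E//= mulN1r.
apply: (lconv_unit_cancel C2 Ck1 (Cm1_lconv CkD Ck) CfP k2E).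
apply: lconv_fun_eq => {}t t0.
rewrite (lconvDl Cf (Cm1Z (-1) CP) C2) (lconvZl _ CP C2) (lconvZl _ Ck1 C2) /=.
rewrite k1E// mulr1 (lconvC Cf C2) mulN1r.
have -> : lconv k2 f t = GFI_at0 k2 f + lconv (cst 1) (GFD k2 f) t by exact: gE.
rewrite addrC addKr.
(* Moving [k2] next to [kappa * k1] turns the left-hand side into [1 * GFD k2 f]. *)
rewrite (lconvC CkD Ck) (lconvA Ck C1 CD) (lconvAC Ck1 CD C2).
by congr (_ _); apply: eq_lconv => // s s0; exact: k1E.
Qed.

Theorem theorem5 (R : realType) (kappa k1 k2 : R -> R)
    (hL : L11 kappa k1 k2) (f : R -> R) (hf : C1m1 k2 f) :
  [/\ GFD1_ex k1 k2 f,
      Cm1 (GFD1 k1 k2 f),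
      C0_ext (GFI k2 f),
      cq_emb kappa (GFD1 k1 k2 f) = AGFD1 kappa k1 k2 f &
      AGFD1 kappa k1 k2 f =
        cq_sub (cq_mul (cq_S kappa) (cq_emb kappa f))
               (cq_emb kappa (fun t => GFI_at0 k2 f * k1 t))].
Proof.
have [Ck C1 C2 k1E] := hL; have [Cf df CD] := hf.
have C12 : Cm1 (lconv k1 k2) by exact: Cm1_lconv.
have kv1 t : 0 < t -> lconv kappa (lconv k1 k2) t = 1.
  by move=> t0; rewrite (lconvA Ck C1 C2) k1E.
have CP : Cm1 (P1L kappa k1 k2 f) by apply: Cm1Z; exact: Cm1_lconv.
have SP : cq_mul (cq_S kappa) (cq_emb kappa (P1L kappa k1 k2 f)) =
    cfrac (P1L kappa k1 k2 f) kappa.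
  exact: (cq_mul_S_emb Ck C12 kv1 CP).
split.
- by move=> t t0; split; [exact: lconv_exP|exact: df|exact: lconv_exP].
- exact: Cm1_lconv.
- by have [] := GFI_primitive hf.
(* Both sides become quotients over [kappa], and it remains to compare numerators. *)
- rewrite /AGFD1 /cq_sub SP (cq_mul_S_emb Ck C12 kv1 Cf).
  rewrite (cq_scale_cfrac Ck C12 kv1 (-1) CP).
  rewrite (cq_add_cfrac Ck C12 kv1 Cf (Cm1Z (-1) CP)).
  apply: cfrac_eq => t t0.
  by rewrite (C1m1_equation hL hf t0) /= mulN1r.
(* The embedding of [c * k1] has numerator [c * (k1 * kappa)], which is [P1L] by commutativity. *)
- rewrite /AGFD1 SP; congr (cq_sub _ _); apply: cfrac_eq => t _.
  by rewrite (lconvZl _ C1 Ck) (lconvC C1 Ck).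
Qed.
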